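(* Let $k\ge 2$. Say that a generating set $\Gamma$ of $G_{k,1}$ satisfies the surjectiveness condition with respect to a generating set $\Delta$ of $\mathsf{riAut}(k)$ if for every $\delta\in\Delta$ there exists $\gamma\in\Gamma$ with $\mathsf{Dom}(\delta)=\mathsf{Dom}(\gamma)$; and that $\Gamma$ satisfies the surjectiveness condition if it does so with respect to some generating set $\Delta$ of $\mathsf{riAut}(k)$. (1) For every generating set $\Delta$ of $\mathsf{riAut}(k)$ there exists a generating set $\Gamma$ of $G_{k,1}$ that satisfies the surjectiveness condition with respect to $\Delta$. If $\Delta$ is finite then $\Gamma$ is finite and $|\Gamma|\le 2\cdot|\Delta|$ (i.e. $\Gamma$ can be so chosen). The generating set $\Gamma=G_{k,1}$ also satisfies the surjectiveness condition. (2) The surjectiveness condition is necessary for the surjectiveness of $\rho$: if $\Gamma$ is a generating set of $G_{k,1}$ such that the homomorphism $\rho:(G_{k,1}^{\sim\mathcal L})_{\Gamma}\to e(\mathsf{riAut}(k))$ is surjective, then $\Gamma$ satisfies the surjectiveness condition. (3) Not every generating set $\Gamma$ of $G_{k,1}$ satisfies the surjectiveness condition. More strongly, for some generating set $\Gamma$ of $G_{2,1}$ there is no surjective homomorphism from $(G_{2,1}^{\sim\mathcal L})_{\Gamma}$ onto $\mathsf{riAut}(2)$.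
   Context: Let $A$ be an alphabet with $|A|=k\ge 2$ and $A^*$ the free monoid. A right ideal is $R\subseteq A^*$ with $RA^*\subseteq R$; it is essential iff it intersects every (nonempty) right ideal. $\mathsf{riAut}(k)$ is the monoid (under composition of partial functions, written on the left of the argument) of all bijections $\varphi:R_1\to R_2$ between finitely generated essential right ideals with $\varphi(xw)=\varphi(x)w$ for $x\in R_1,w\in A^*$; $\mathsf{Dom}(\varphi)=R_1$. Every $\varphi\in\mathsf{riAut}(k)$ has a unique maximal extension $\max(\varphi)\in\mathsf{riAut}(k)$. $G_{k,1}=\{\max(\varphi):\varphi\in\mathsf{riAut}(k)\}$ with multiplication $\psi\cdot\varphi=\max(\psi\circ\varphi)$ is a group (the Thompson-Higman group). Let $\eta(\varphi)=\max(\varphi)$. For $g\in G_{k,1}$, $\mathsf{Dom}(g)$ is the domain of $g$ as a maximally extended map. $\mathcal{I_R}$ is the set of finitely generated essential right ideals of $A^*$ (closed under intersection; these are the sets $PA^*$ with $P$ a finite maximal prefix code). $G_{k,1}\ltimes\mathcal{I_R}$ is the set of pairs with the associative multiplication $(g_2,P_2A^* )*(g_1,P_1A^* )=(g_2g_1,\ g_1^{-1}(P_2A^* )\cap P_1A^* )$, with $g_1^{-1}(\cdot)$ the preimage under the partial map $g_1$. The map $e:\mathsf{riAut}(k)\to G_{k,1}\ltimes\mathcal{I_R}$, $e(\varphi)=(\eta(\varphi),\mathsf{Dom}(\varphi))$, is an injective homomorphism. Generating sets are meant as monoid generating sets. For a monoid $M$ with generating set $\Gamma$, the $\Gamma$-generated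 suffix expansion $(\tilde M^{\mathcal L})_{\Gamma}$ (written $(G^{\sim\mathcal L})_\Gamma$ when $M=G$) is the submonoid generated by $\{(\gamma,\{\gamma,1\}):\gamma\in\Gamma\}$ of the monoid of pairs $(x,S)$ with $x\in M$, $S\subseteq M$ finite, with multiplication $(y,T)\cdot(x,S)=(yx,\ Tx\cup S)$. The homomorphism $\rho:(G_{k,1}^{\sim\mathcal L})_{\Gamma}\to e(\mathsf{riAut}(k))$ is $\rho(g,S)=(g,\bigcap_{h\in S}\mathsf{Dom}(h))$. *)

(* Defs.v *)
From HB Require Import structures.
From mathcomp Require Import all_boot finmap.
From mathcomp Require Import boolp classical_sets functions cardinality.
Set Implicit Arguments.
Unset Strict Implicit.
Unset Printing Implicit Defensive.

Local Open Scope group_scope.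
Local Open Scope fset_scope.
Local Open Scope classical_set_scope.

Section GeneratedSubmonoid.
Variable M : monoidType.
Implicit Types (X Y : set M).

Definition submonoid X := X 1 /\ forall x y, X x -> X y -> X (x * y).

Definition generated_submonoid X : set M := smallest submonoid X.

Definition generates X := generated_submonoid X = [set: M].

Lemma submonoid_generated X : submonoid (generated_submonoid X).
Proof.
split=> [Y [[Y1 _] _] //|x y Xx Xy Y [sY XY]].
by apply: sY.2; [apply: Xx|apply: Xy].
Qed.

End GeneratedSubmonoid.

Section RightIdeals.
Variable A : finType.
Local Notation word := (seq A).
Implicit Types (P R : set word).

Definition right_ideal R := forall x w : word, R x -> R (x ++ w).

Definition essential R :=
  right_ideal R /\
  forall R' : set word, right_ideal R' -> R' !=set0 -> R `&` R' !=set0.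

(* the right ideal [P A^*] *)
Definition ideal_of P : set word := [set x | exists2 p, P p & exists w, x = p ++ w].

Definition finitely_generated R := exists2 P, finite_set P & R = ideal_of P.

Definition fg_essential R := finitely_generated R /\ essential R.

Lemma fg_essentialP R : fg_essential R <->
  [/\ right_ideal R, forall x, exists w, R (x ++ w)
    & exists N, forall x, (N <= size x)%N -> R x].
Proof.
split.
  case=> -[P /finite_seqP[s Ps] RE] [rR eR]; split=> //.
    move=> x; case: (eR (ideal_of [set x])).
    - by move=> y w [p -> [u ->]]; exists x => //; exists (u ++ w); rewrite catA.
    - by exists x; exists x => //; exists [::]; rewrite cats0.
    - by move=> z [Rz [p -> [w zE]]]; exists w; rewrite -zE.
  exists (\max_(p <- s) size p) => x sx.
  case: (eR (ideal_of [set x])).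
  - by move=> y w [p -> [u ->]]; exists x => //; exists (u ++ w); rewrite catA.
  - by exists x; exists x => //; exists [::]; rewrite cats0.
  move=> z [Rz [_ -> [w zE]]].
  move: Rz; rewrite RE => -[p Pp [u zE']].
  have sp : (size p <= size x)%N.
    apply: leq_trans sx; rewrite (@leq_bigmax_seq _ s xpredT size) //.
    by move: Pp; rewrite Ps.
  exists p => //; exists (drop (size p) x).
  have := congr1 (take (size p)) zE.
  by rewrite zE' take_size_cat // takel_cat // => pE;
    rewrite -[LHS](cat_take_drop (size p)) -pE.
case=> rR dR [N lR]; split; last first.
  split=> // R' rR' [r Rr]; have [w Rrw] := dR r.
  by exists (r ++ w); split=> //; apply: rR'.
exists [set x | R x /\ (size x <= N)%N].
  pose f (u : {n : 'I_N.+1 & n.-tuple A}) : word := tval (tagged u).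
  apply: (@sub_finite_set _ _ [set f u | u in setT]); last first.
    by apply: finite_image; apply: finite_finset.
  move=> x [_ sx].
  exists (existT (fun n : 'I_N.+1 => n.-tuple A) (Ordinal (sx : size x < N.+1)%N)
    (in_tuple x)) => //.
apply/seteqP; split=> x.
  move=> Rx; have [sx|sx] := leqP (size x) N.
    by exists x; [split|exists [::]; rewrite cats0].
  exists (take N x); last by exists (drop N x); rewrite cat_take_drop.
  by split; [apply: lR|]; rewrite size_takel // ltnW.
by move=> [p [Rp _] [w ->]]; apply: rR.
Qed.

Lemma fg_essentialT : fg_essential [set: word].
Proof.
by apply/fg_essentialP; split=> //; [move=> x; exists [::]|exists 0].
Qed.

Lemma fg_essentialI R1 R2 :
  fg_essential R1 -> fg_essential R2 -> fg_essential (R1 `&` R2).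
Proof.
move=> /fg_essentialP[r1 d1 [N1 l1]] /fg_essentialP[r2 d2 [N2 l2]].
apply/fg_essentialP; split.
- by move=> x w [/r1 R1x /r2 R2x].
- move=> x; have [w1 R1x] := d1 x; have [w2 R2x] := d2 (x ++ w1).
  by exists (w1 ++ w2); rewrite catA; split=> //; apply: r1.
- exists (maxn N1 N2) => x; rewrite geq_max => /andP[/l1 R1x /l2 R2x].
  by split.
Qed.

End RightIdeals.

Record fgeri (A : finType) := Fgeri {
  ideal_set :> set (seq A);
  _ : `[< fg_essential ideal_set >] }.

HB.instance Definition _ A := [isSub for @ideal_set A].
HB.instance Definition _ A := [Choice of fgeri A by <:].

Section Fgeri.
Variable A : finType.
Implicit Types (R : fgeri A).

Lemma fgeriP R : fg_essential R.
Proof. by apply/asboolP/(valP R). Qed.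

Definition mk_fgeri (X : set (seq A)) (hX : fg_essential X) : fgeri A :=
  Fgeri (asboolT hX).

Lemma fgeri_inj R1 R2 : ideal_set R1 = ideal_set R2 -> R1 = R2.
Proof. exact: val_inj. Qed.

End Fgeri.

Section PartialMaps.
Variable A : finType.
Local Notation word := (seq A).
Implicit Types (f g : word -> option word) (x y z w : word).

Definition dom f : set word := [set x | exists y, f x = Some y].
Definition ran f : set word := [set y | exists x, f x = Some y].

Definition is_riAut f :=
  [/\ fg_essential (dom f), fg_essential (ran f),
      forall x x' y, f x = Some y -> f x' = Some y -> x = x'
    & forall x w y, f x = Some y -> f (x ++ w) = Some (y ++ w)].

Definition pcomp2 g f : word -> option word := fun x => obind g (f x).

Lemma pcomp2E g f x z :
  pcomp2 g f x = Some z <-> exists2 y, f x = Some y & g y = Some z.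
Proof.
rewrite /pcomp2; case: (f x) => [y|] /=; split=> //.
- by exists y.
- by case=> _ [<-].
- by case.
Qed.

Definition pinv f : word -> option word := fun y =>
  if pselect (exists x, f x = Some y) is left h then Some (sval (cid h)) else None.

Lemma pinvE f x y : is_riAut f -> pinv f y = Some x <-> f x = Some y.
Proof.
case=> _ _ injf _; rewrite /pinv; case: pselect => [h|nh]; split=> //.
- by case=> <-; case: cid.
- by move=> fx; congr Some; case: cid => x' /= fx'; apply: injf fx' fx.
- by move=> fx; case: nh; exists x.
Qed.

Lemma dom_pinv f : is_riAut f -> dom (pinv f) = ran f.
Proof.
by move=> rf; apply/seteqP; split=> y [x /(pinvE _ _ rf) h]; exists x => //.
Qed.

Lemma ran_pinv f : is_riAut f -> ran (pinv f) = dom f.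
Proof.
by move=> rf; apply/seteqP; split=> y [x /(pinvE _ _ rf) h]; exists x => //.
Qed.

Lemma is_riAut_inv f : is_riAut f -> is_riAut (pinv f).
Proof.
move=> rf; have [df rgf injf hf] := rf; split.
- by rewrite dom_pinv.
- by rewrite ran_pinv.
- by move=> y y' x /(pinvE _ _ rf) h /(pinvE _ _ rf); rewrite h => -[].
- by move=> y w x /(pinvE _ _ rf) /hf h; apply/(pinvE _ _ rf).
Qed.

Definition preim f (R : set word) : set word :=
  [set x | exists2 y, f x = Some y & R y].

Lemma fg_essential_preim f (R : set word) :
  is_riAut f -> fg_essential R -> fg_essential (preim f R).
Proof.
case=> /fg_essentialP[rf df [N lf]] _ _ hf /fg_essentialP[rR dR [N' lR]].
apply/fg_essentialP; split.
- by move=> x w [y fx Ry]; exists (y ++ w); [apply: hf|apply: rR].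
- move=> x; have [w [y fx]] := df x; have [u Ry] := dR y.
  by exists (w ++ u), (y ++ u) => //; rewrite catA; apply: hf.
- exists (N + N')%N => x sx.
  have [|y fy] := lf (take N x).
    by rewrite size_takel // (leq_trans _ sx) ?leq_addr.
  exists (y ++ drop N x); first by rewrite -{1}(cat_take_drop N x); apply: hf.
  by apply: lR; rewrite size_cat size_drop (leq_trans _ (leq_addl _ _)) // leq_subRL
    // (leq_trans _ sx) ?leq_addr.
Qed.

Lemma is_riAut_comp g f : is_riAut g -> is_riAut f -> is_riAut (pcomp2 g f).
Proof.
move=> rg rf; split.
- have -> : dom (pcomp2 g f) = preim f (dom g).
    apply/seteqP; split=> x.
      by move=> [z /pcomp2E[y fx gy]]; exists y => //; exists z.
    by move=> [y fx [z gy]]; exists z; apply/pcomp2E; exists y.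
  by apply: fg_essential_preim => //; case: rg.
- have -> : ran (pcomp2 g f) = preim (pinv g) (ran f).
    apply/seteqP; split=> z.
      by move=> [x /pcomp2E[y fx gy]]; exists y; [apply/pinvE|exists x].
    by move=> [y /(pinvE _ _ rg) gy [x fx]]; exists x; apply/pcomp2E; exists y.
  by apply: fg_essential_preim; [apply: is_riAut_inv|case: rf].
- case: rg rf => _ _ injg _ [_ _ injf _] x x' z.
  move=> /pcomp2E[y fx gy] /pcomp2E[y' fx' gy'].
  by apply: injf fx _; rewrite (injg _ _ _ gy gy').
- case: rg rf => _ _ _ hg [_ _ _ hf] x w z /pcomp2E[y fx gy].
  by apply/pcomp2E; exists (y ++ w); [apply: hf|apply: hg].
Qed.

Lemma is_riAut_id : is_riAut (@Some word).
Proof.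
have dE : dom (@Some word) = setT by apply/seteqP; split=> // x _; exists x.
have rE : ran (@Some word) = setT by apply/seteqP; split=> // x _; exists x.
split; rewrite ?dE ?rE; try exact: fg_essentialT.
- by move=> x x' y [<-] [<-].
- by move=> x w y [<-].
Qed.

End PartialMaps.

Record riAut (A : finType) := RiAut {
  pfun :> seq A -> option (seq A);
  _ : `[< is_riAut pfun >] }.

HB.instance Definition _ A := [isSub for @pfun A].
HB.instance Definition _ A := [Choice of riAut A by <:].

Section RiAut.
Variable A : finType.
Local Notation word := (seq A).
Implicit Types (f g h : riAut A) (x y z w : word).

Lemma riAutP f : is_riAut f.
Proof. by apply/asboolP/(valP f). Qed.

Lemma riAut_ext f g :
  (forall x y, f x = Some y <-> g x = Some y) -> f = g.
Proof.
move=> fg; apply/val_inj/funext => x /=.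
case fx: (f x) => [y|]; first by have /fg -> := fx.
by case gx: (g x) => [y|//]; have /fg := gx; rewrite fx.
Qed.

(* [comp_riAut g f] is g o f: [f] is applied first *)
Definition comp_riAut g f := RiAut (asboolT (is_riAut_comp (riAutP g) (riAutP f))).
Definition id_riAut := RiAut (asboolT (@is_riAut_id A)).
Definition inv_riAut f := RiAut (asboolT (is_riAut_inv (riAutP f))).

Lemma comp_riAutA : associative comp_riAut.
Proof.
move=> h g f; apply: val_inj; apply: funext => x /=; rewrite /pcomp2.
by case: (pfun f x).
Qed.

Lemma comp_id_riAut : left_id id_riAut comp_riAut.
Proof.
by move=> f; apply: val_inj; apply: funext => x /=; rewrite /pcomp2; case: (pfun f x).
Qed.

Lemma comp_riAut_id : right_id id_riAut comp_riAut.
Proof. by move=> f; apply: val_inj; apply: funext. Qed.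

End RiAut.

HB.instance Definition _ (A : finType) :=
  isMonoid.Build (riAut A) (@comp_riAutA A) (@comp_id_riAut A) (@comp_riAut_id A).

Section RiAutMax.
Variable A : finType.
Local Notation word := (seq A).
Implicit Types (f g h : riAut A) (x y z w : word).

Lemma mul_riAutE g f x z :
  (g * f) x = Some z <-> exists2 y, f x = Some y & g y = Some z.
Proof. exact: pcomp2E. Qed.

Definition Dom f : fgeri A :=
  mk_fgeri (let: And4 h _ _ _ := riAutP f in h).

Definition extends f g := forall x y, f x = Some y -> g x = Some y.

Definition maximal_extension f g :=
  extends f g /\ forall h, extends g h -> h = g.

Let catIw w : injective (cat^~ w).
Proof. by move=> x y /(congr1 rev); rewrite !rev_cat => /eqP; rewrite
  eqseq_cat // eqxx => /eqP /(can_inj revK). Qed.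

Let mrel f x y := forall w z, f (x ++ w) = Some z -> z = y ++ w.

Let dense f x : exists w z, f (x ++ w) = Some z.
Proof. by have [/fg_essentialP[_ + _] _ _ _] := riAutP f; apply. Qed.

Let hom f x w y : f x = Some y -> f (x ++ w) = Some (y ++ w).
Proof. by have [_ _ _] := riAutP f; apply. Qed.

Let mx f : word -> option word := fun x =>
  if pselect (exists y, mrel f x y) is left h then Some (sval (cid h)) else None.

Let mxE f x y : mx f x = Some y <-> mrel f x y.
Proof.
rewrite /mx; case: pselect => [h|nh]; split=> //.
- by case=> <-; case: cid.
- move=> mxy; congr Some; case: cid => y' /= mxy'.
  have [w [z fxw]] := dense f x.
  by apply: (@catIw w); rewrite -(mxy _ _ fxw) -(mxy' _ _ fxw).
- by move=> mxy; case: nh; exists y.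
Qed.

Let ext_mx f g x y : extends f g -> g x = Some y -> mrel f x y.
Proof. by move=> fg gx w z /fg; rewrite (hom w gx) => -[]. Qed.

Let is_riAut_mx f : is_riAut (mx f).
Proof.
have fm x y : f x = Some y -> mx f x = Some y.
  by move=> fx; apply/mxE; apply: (@ext_mx f f).
have homm x w y : mx f x = Some y -> mx f (x ++ w) = Some (y ++ w).
  move=> /mxE m; apply/mxE => v z; rewrite -!catA; exact: m.
have [/fg_essentialP[r1 d1 [N1 l1]] /fg_essentialP[r2 d2 [N2 l2]] inj _] := riAutP f.
split=> //.
- apply/fg_essentialP; split.
  + by move=> x w [y /homm h]; exists (y ++ w).
  + by move=> x; have [w [y /fm h]] := d1 x; exists w, y.
  + by exists N1 => x /l1[y /fm h]; exists y.
- apply/fg_essentialP; split.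
  + by move=> y w [x /homm h]; exists (x ++ w).
  + by move=> x; have [w [y /fm h]] := d2 x; exists w, y.
  + by exists N2 => x /l2[y /fm h]; exists y.
- move=> x x' y /mxE m /mxE m'.
  have [w [z fxw]] := dense f x; have [w' [z' fx'w]] := dense f (x' ++ w).
  have zE := m _ _ fxw; have z'E := m' (w ++ w') z'; rewrite catA in z'E.
  have {}z'E := z'E fx'w; have fxww' := hom w' fxw.
  apply: (@catIw (w ++ w')); rewrite !catA.
  by apply: (inj _ _ _ fxww'); rewrite fx'w z'E zE catA.
Qed.

Let mxr f := RiAut (asboolT (is_riAut_mx f)).

Let mxr_max f : maximal_extension f (mxr f).
Proof.
split=> [x y fx|h fh]; first by apply/mxE; apply: (@ext_mx f f).
have fh' : extends f h.
  by move=> x y fx; apply: fh; apply/mxE; apply: (@ext_mx f f).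
by apply: riAut_ext => x y; split=> [hx|/fh//]; apply/mxE; apply: ext_mx hx.
Qed.

Let maximal_mxr f g : maximal_extension f g -> g = mxr f.
Proof.
by move=> [fg mg]; rewrite (mg (mxr f))// => x y gx; apply/mxE; apply: ext_mx gx.
Qed.

Lemma maximal_extension_ex f : exists g, maximal_extension f g.
Proof. by exists (mxr f). Qed.

Lemma maximal_extension_unique f g h :
  maximal_extension f g -> maximal_extension f h -> g = h.
Proof. by move=> /maximal_mxr -> /maximal_mxr ->. Qed.

Definition max_ext f : riAut A := sval (cid (maximal_extension_ex f)).

Lemma max_extP f : maximal_extension f (max_ext f).
Proof. exact: svalP. Qed.

Lemma max_extE f x y : max_ext f x = Some y <->
  forall w z, f (x ++ w) = Some z -> z = y ++ w.
Proof. by rewrite (maximal_mxr (max_extP f)); apply: mxE. Qed.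

Lemma extends_max f : extends f (max_ext f).
Proof. by have [] := max_extP f. Qed.

Lemma max_extends f g : extends f g -> max_ext g = max_ext f.
Proof.
move=> fg; apply: (@maximal_extension_unique f); last exact: max_extP.
split=> [x y /fg /extends_max//|]; by have [] := max_extP g.
Qed.

Lemma max_ext_idem f : max_ext (max_ext f) = max_ext f.
Proof. by apply: max_extends; apply: extends_max. Qed.

Lemma max_extM g f : max_ext (max_ext g * max_ext f) = max_ext (g * f).
Proof.
apply: max_extends => x z /mul_riAutE[y /extends_max fx /extends_max gy].
by apply/mul_riAutE; exists y.
Qed.

End RiAutMax.

Record thompson (A : finType) := Thompson {
  maxmap :> riAut A;
  _ : `[< range (@max_ext A) maxmap >] }.

HB.instance Definition _ A := [isSub for @maxmap A].
HB.instance Definition _ A := [Choice of thompson A by <:].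

Section Thompson.
Variable A : finType.
Implicit Types (f : riAut A) (g h : thompson A).

Definition eta f : thompson A :=
  Thompson (asboolT (imageT (@max_ext A) f)).

Lemma eta_maxmap g : eta g = g.
Proof.
apply: val_inj => /=; have /asboolP[f _ <-] := valP g; exact: max_ext_idem.
Qed.

Lemma max_thompson g : max_ext g = g.
Proof. exact: (congr1 val (eta_maxmap g)). Qed.

Definition mul_thompson h g := eta (comp_riAut h g).
Definition one_thompson := eta (id_riAut A).
Definition inv_thompson g := eta (inv_riAut g).

Lemma mul_eta f1 f2 : mul_thompson (eta f1) (eta f2) = eta (f1 * f2).
Proof. by apply: val_inj; apply: max_extM. Qed.

Lemma mul_thompsonA : associative mul_thompson.
Proof.
move=> g1 g2 g3.
by rewrite -(eta_maxmap g1) -(eta_maxmap g2) -(eta_maxmap g3) !mul_eta mulgA.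
Qed.

Lemma mul1_thompson : left_id one_thompson mul_thompson.
Proof. by move=> g; rewrite -(eta_maxmap g) mul_eta mul1g. Qed.

Lemma mul_thompson1 : right_id one_thompson mul_thompson.
Proof. by move=> g; rewrite -(eta_maxmap g) mul_eta mulg1. Qed.

Lemma mulV_thompson : left_inverse one_thompson inv_thompson mul_thompson.
Proof.
move=> g; rewrite -{2}(eta_maxmap g) mul_eta; apply: val_inj => /=.
apply/esym/max_extends => x z /mul_riAutE[y gx] /(pinvE _ _ (riAutP g)) gz.
by have [_ _ inj _] := riAutP g; rewrite (inj _ _ _ gx gz).
Qed.

Lemma mul_thompsonV : right_inverse one_thompson inv_thompson mul_thompson.
Proof.
move=> g; rewrite -{1}(eta_maxmap g) mul_eta; apply: val_inj => /=.
apply/esym/max_extends => x z /mul_riAutE[y] /(pinvE _ _ (riAutP g)) gy.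
by rewrite gy => -[->].
Qed.

End Thompson.

HB.instance Definition _ (A : finType) := isGroup.Build (thompson A)
  (@mul_thompsonA A) (@mul1_thompson A) (@mul_thompson1 A)
  (@mulV_thompson A) (@mul_thompsonV A).

Lemma eta_monoid_morphism (A : finType) : monoid_morphism (@eta A).
Proof. by split=> // f1 f2; rewrite -mul_eta. Qed.

HB.instance Definition _ (A : finType) :=
  isUMagmaMorphism.Build (riAut A) (thompson A) (@eta A) (@eta_monoid_morphism A).

Definition semidirect (A : finType) : Type := (thompson A * fgeri A)%type.

HB.instance Definition _ A := Choice.on (semidirect A).

Section Semidirect.
Variable A : finType.
Implicit Types (g h : thompson A) (u v : semidirect A).

Lemma mul_thompson_def h g x y z :
  g x = Some y -> (h * g) x = Some z <-> h y = Some z.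
Proof.
move=> gx; split=> [|hy]; last first.
  by apply: extends_max; apply/mul_riAutE; exists y.
move=> hgx; rewrite -(max_thompson h); apply/max_extE => w u hyw.
move: hgx => /max_extE; apply; apply/mul_riAutE; exists (y ++ w) => //.
by have [_ _ _ hom] := riAutP g; apply: hom.
Qed.

Lemma one_thompsonE x : (1 : thompson A) x = Some x.
Proof. exact: extends_max. Qed.

Definition preim_fgeri g (R : fgeri A) : fgeri A :=
  mk_fgeri (fg_essential_preim (riAutP g) (fgeriP R)).

Definition cap_fgeri (R1 R2 : fgeri A) : fgeri A :=
  mk_fgeri (fg_essentialI (fgeriP R1) (fgeriP R2)).

Definition full_fgeri : fgeri A := mk_fgeri (@fg_essentialT A).

Definition mul_semidirect v u : semidirect A :=
  (v.1 * u.1, cap_fgeri (preim_fgeri u.1 v.2) u.2).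

Lemma mul_semidirectA : associative mul_semidirect.
Proof.
move=> [g3 R3] [g2 R2] [g1 R1]; congr pair; rewrite /= ?mulgA//.
apply: fgeri_inj; apply/seteqP; split=> x /=.
  move=> [[z g21x R3z] [[y g1x R2y] R1x]]; split=> //.
  exists y => //; split=> //; exists z => //.
  by apply/(mul_thompson_def _ _ g1x).
move=> [[y g1x [[z g2y R3z] R2y]] R1x]; split; last by split=> //; exists y.
by exists z => //; apply/(mul_thompson_def _ _ g1x).
Qed.

End Semidirect.

(* Only a semigroup: the product of [(1, setT)] and [(g, R)] is
   [(g, Dom g `&` R)]. *)
HB.instance Definition _ (A : finType) :=
  isSemigroup.Build (semidirect A) (@mul_semidirectA A).

Definition embed (A : finType) (f : riAut A) : semidirect A := (eta f, Dom f).

Section Embed.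
Variable A : finType.

Lemma embed_mul : {morph @embed A : g f / g * f}.
Proof.
move=> g f; congr pair; first exact: gmulfM.
apply: fgeri_inj; apply/seteqP; split=> x /=.
  move=> [z /mul_riAutE[y fx gy]]; split; last by exists y.
  by exists y; [apply: extends_max|exists z].
move=> [[y' /extends_max + [z gy]] [y fx]].
move=> efx; exists z; apply/mul_riAutE; exists y => //.
by move: efx; rewrite max_ext_idem (extends_max fx) => -[->].
Qed.

HB.instance Definition _ := isMultiplicative.Build _ _ (@embed A) embed_mul.

Lemma embed_inj : injective (@embed A).
Proof.
move=> f g [mfg dfg]; apply: riAut_ext.
have aux (f1 f2 : riAut A) : max_ext f1 = max_ext f2 -> dom f1 = dom f2 ->
    extends f1 f2.
  move=> m d x y fx; have : dom f2 x by rewrite -d; exists y.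
  move=> [y' gx]; rewrite gx; have := extends_max gx.
  by rewrite -m (extends_max fx).
by move=> x y; split; apply: aux.
Qed.

Lemma embedP (g : thompson A) (R : fgeri A) :
  range (@embed A) (g, R) <-> R `<=` Dom g.
Proof.
split=> [[f _ [<- <-]] x [y fx]|RD]; first by exists y; apply: extends_max.
pose r x := if `[< ideal_set R x >] then g x else None.
have rE x y : r x = Some y <-> ideal_set R x /\ g x = Some y.
  by rewrite /r; case: asboolP => Rx; split=> // -[].
have [rR _ _] := (fg_essentialP R).1 (fgeriP R).
have [_ rg inj hom] := riAutP g.
have dr : dom r = R.
  apply/seteqP; split=> x; first by move=> [y /rE[]].
  by move=> Rx; have [y gx] := RD _ Rx; exists y; apply/rE.
have rr : is_riAut r; last first.
  exists (RiAut (asboolT rr)) => //; congr pair; last exact: fgeri_inj.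
  rewrite -[RHS]eta_maxmap; apply: val_inj; apply/esym/max_extends.
  by move=> x y /= /rE[].
split.
- by rewrite dr; apply: fgeriP.
- have -> : ran r = preim (pinv g) R.
    apply/seteqP; split=> y.
      by move=> [x /rE[Rx gx]]; exists x => //; apply/(pinvE _ _ (riAutP g)).
    by move=> [x /(pinvE _ _ (riAutP g)) gx Rx]; exists x; apply/rE.
  by apply: fg_essential_preim; [apply: is_riAut_inv (riAutP g)|apply: fgeriP].
- by move=> x x' y /rE[_ gx] /rE[_]; apply: inj.
- by move=> x w y /rE[Rx gx]; apply/rE; split; [apply: rR|apply: hom].
Qed.

End Embed.

Definition suffix_pair (M : monoidType) : Type := (M * {fset M})%type.

HB.instance Definition _ (M : monoidType) := Choice.on (suffix_pair M).

Section SuffixPair.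
Variable M : monoidType.
Implicit Types (p q : suffix_pair M).

Definition mul_suffix_pair q p : suffix_pair M :=
  (q.1 * p.1, ([fset t * p.1 | t in q.2] `|` p.2)%fset).

(* All finite sets are allowed as second component, so the unit is (1, fset0),
   not (1, {1}). *)
Definition one_suffix_pair : suffix_pair M := (1, fset0).

Lemma mul_suffix_pairA : associative mul_suffix_pair.
Proof.
move=> [z U] [y T] [x S]; congr pair; rewrite /= ?mulgA//.
rewrite imfsetU fsetUA; congr (_ `|` _ `|` _)%fset.
apply/fsetP => a; apply/imfsetP/imfsetP => /= -[b].
  by move=> bU ->; exists (b * y); [apply/imfsetP; exists b|rewrite mulgA].
by move=> /imfsetP[c /= cU ->] ->; exists c; rewrite ?mulgA.
Qed.

Lemma mul1_suffix_pair : left_id one_suffix_pair mul_suffix_pair.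
Proof.
by move=> [x S]; rewrite /mul_suffix_pair /= mul1g imfset0 fset0U.
Qed.

Lemma mul_suffix_pair1 : right_id one_suffix_pair mul_suffix_pair.
Proof.
move=> [x S]; rewrite /mul_suffix_pair /= mulg1 fsetU0; congr pair.
apply/fsetP => a; apply/imfsetP/idP => /= [[b bS ->]|aS].
  by rewrite mulg1.
by exists a; rewrite ?mulg1.
Qed.

End SuffixPair.

HB.instance Definition _ (M : monoidType) := isMonoid.Build (suffix_pair M)
  (@mul_suffix_pairA M) (@mul1_suffix_pair M) (@mul_suffix_pair1 M).

Definition suffix_generator (M : monoidType) (x : M) : suffix_pair M :=
  (x, [fset x; 1]%fset).

Definition in_suffix_expansion (M : monoidType) (G : set M) : pred (suffix_pair M) :=
  fun p => `[< generated_submonoid (@suffix_generator M @` G) p >].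

Record suffix_expansion (M : monoidType) (G : set M) := SuffixExpansion {
  suffix_val :> suffix_pair M;
  _ : in_suffix_expansion G suffix_val }.

HB.instance Definition _ (M : monoidType) (G : set M) :=
  [isSub for @suffix_val M G].
HB.instance Definition _ (M : monoidType) (G : set M) :=
  [Choice of suffix_expansion G by <:].

Lemma suffix_expansion_closed (M : monoidType) (G : set M) :
  umagma_closed (in_suffix_expansion G).
Proof.
have [h1 hM] := submonoid_generated (@suffix_generator M @` G).
split; first exact/asboolP.
by move=> p q /asboolP hp /asboolP hq; apply/asboolP; apply: hM.
Qed.

HB.instance Definition _ (M : monoidType) (G : set M) :=
  SubChoice_isSubMonoid.Build (suffix_pair M) (in_suffix_expansion G)
    (suffix_expansion G) (suffix_expansion_closed G).

Lemma suffix_expansionP (M : monoidType) (G : set M) (p : suffix_expansion G) :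
  suffix_val p = 1 \/ (suffix_val p).1 \in (suffix_val p).2.
Proof.
have /asboolP hp := valP p.
pose Q : set (suffix_pair M) := 
  [set q : suffix_pair M | q = 1 \/ q.1 \in q.2].
suff sQ : generated_submonoid (@suffix_generator M @` G) `<=` Q by exact: sQ hp.
apply: smallest_sub.
  split=> [|x y]; first by left.
  move=> [->|hx]; first by rewrite mul1g.
  move=> hy; right; rewrite in_fsetU; apply/orP; left.
  by apply/imfsetP; exists x.1.
by move=> _ [x _ <-]; right; rewrite !inE eqxx.
Qed.

Section Rho.
Variable A : finType.

(* with the convention that the empty intersection is [A^*] *)
Lemma fg_essential_bigcap (S : {fset thompson A}) :
  fg_essential (\bigcap_(h in [set` S]) (Dom h : set (seq A))).
Proof.
rewrite bigcap_fset; elim/big_ind: _ => //.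
- exact: fg_essentialT.
- exact: fg_essentialI.
- by move=> h _; apply: fgeriP.
Qed.

Variable G : set (thompson A).

Definition rho (p : suffix_expansion G) : semidirect A :=
  ((suffix_val p).1, mk_fgeri (fg_essential_bigcap (suffix_val p).2)).

Lemma rho_mul : {morph rho : q p / q * p}.
Proof.
move=> q p; congr pair => /=.
apply: fgeri_inj => /=.
set y := (suffix_val q).1; set T := (suffix_val q).2.
set x := (suffix_val p).1; set S := (suffix_val p).2.
have xS : (x = 1 /\ S = fset0) \/ x \in S.
  rewrite /x /S; case: (suffix_expansionP p) => [->|]; last by right.
  by left.
change (\bigcap_(h in [set` ([fset t * x | t in T] `|` S)%fset]) dom h =
  preim x (\bigcap_(h in [set` T]) dom h) `&` \bigcap_(h in [set` S]) dom h).
apply/seteqP; split=> z /=.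
  move=> hz; split; last by move=> h hS; apply: hz; rewrite /= in_fsetU hS orbT.
  have [y' xz] : dom x z.
    case: xS => [[-> _]|xS]; first by exists z; apply: one_thompsonE.
    by apply: hz; rewrite /= in_fsetU xS orbT.
  exists y' => // h hT; have [|u hxz] := hz (h * x).
    by rewrite /= in_fsetU; apply/orP; left; apply/imfsetP; exists h.
  by exists u; apply/(mul_thompson_def _ _ xz).
move=> [[y' xz hy'] hS] h /=; rewrite in_fsetU => /orP[|/hS//].
move=> /imfsetP[t /= tT ->]; have [u ty'] := hy' _ tT.
by exists u; apply/(mul_thompson_def _ _ xz).
Qed.

HB.instance Definition _ := isMultiplicative.Build _ _ rho rho_mul.

Lemma rho1 : rho 1 = embed 1.
Proof.
congr pair; apply: fgeri_inj; apply/seteqP; split=> x /=; first by exists x.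
by move=> _ h; rewrite /= in_fset0.
Qed.

Lemma rho_range p : range (@embed A) (rho p).
Proof.
apply/embedP => x /= hx; case: (suffix_expansionP p) => [->|h]; last exact: hx.
by exists x; apply: one_thompsonE.
Qed.

End Rho.

Definition surj_condition_wrt (A : finType)
    (G : set (thompson A)) (D : set (riAut A)) :=
  forall d, D d -> exists2 g, G g & Dom d = Dom g.

Definition surj_condition (A : finType) (G : set (thompson A)) :=
  exists2 D : set (riAut A), generates D & surj_condition_wrt G D.

(* Main.v *)
Require Import Defs.
From mathcomp Require Import all_boot finmap.
From mathcomp Require Import boolp classical_sets functions cardinality.

(* Write [code R] for the maximal prefix code generating [R]. Swapping two
   letters in every caret [q A] contained in [code R] gives an involution of
   [code R] whose right ideal automorphism has no proper extension, so every
   [R] is the domain of an involution of the Thompson-Higman group [G].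

   The only element of [riAut A] defined at the empty word is 1, so a
   generating set of [riAut A] must contain a map with domain [A^{>=1}], while
   [G] is generated by its elements with any other domain. This makes the
   surjectiveness condition fail.

   For two letters, [G] is generated by [{g | g^3 = 1}]: moving a caret of the
   range onto the image of a caret of the domain by swaps of code words enlarges
   the domain, so swaps generate; and the swap of [u] and [v] is the product
   of the swaps of [u0], [v0] and of [u1], [v1], hence a product of two
   3-cycles. The exchange [s] of the two letters is irreducible in [riAut A],
   so a surjection from the suffix expansion sends some generator
   [(g, {g, 1})], [g^3 = 1], to [s]. The fifth and second powers of that
   generator agree, but [s^5 = s <> s^2]. *)

Set Implicit Arguments.
Unset Strict Implicit.
Unset Printing Implicit Defensive.

Local Open Scope group_scope.
Local Open Scope classical_set_scope.

(** * Prefix codes and involutions with a prescribed domain *)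

Section Codes.
Variable A : finType.
Local Notation word := (seq A).
Implicit Types (R : set word) (p q u v w x y : word).

Lemma catIr w : injective (cat^~ w).
Proof.
by move=> x y; elim/last_ind: w => [|w a IH]; rewrite ?cats0 // -!rcons_cat
  => /rcons_inj[/IH].
Qed.

Definition code R : set word :=
  [set p | R p /\ forall q w, p = q ++ w -> R q -> w = [::]].

Lemma code_prefix R x : R x -> exists p w, code R p /\ x = p ++ w.
Proof.
move=> Rx; have exn : exists n, `[< R (take n x) >].
  by exists (size x); apply/asboolP; rewrite take_size.
case: (ex_minnP exn) => n /asboolP Rn minn.
exists (take n x), (drop n x); split; last by rewrite cat_take_drop.
split=> // q w E Rq; have xE : x = q ++ (w ++ drop n x).
  by rewrite catA -E cat_take_drop.
have : n <= size q by apply: minn; apply/asboolP; rewrite xE take_size_cat.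
move/(congr1 size): E; rewrite size_cat size_take_min => E nq.
by apply/nilP; rewrite /nilp -leqn0 -(leq_add2l (size q)) addn0 -E geq_min nq.
Qed.

Lemma code_uniq R p q w v :
  code R p -> code R q -> p ++ w = q ++ v -> p = q /\ w = v.
Proof.
wlog pq : p q w v / size p <= size q.
  move=> H cp cq E; have [pq|/ltnW qp] := leqP (size p) (size q); first exact: H.
  by have [-> ->] := H q p v w qp cq cp (esym E).
move=> [Rp _] [_ mq] E.
have qE : q = p ++ drop (size p) q.
  have /(congr1 (take (size p))) := E.
  by rewrite take_size_cat // takel_cat // => pE; rewrite {1}pE cat_take_drop.
have {}qE : q = p by rewrite qE (mq _ _ qE Rp) cats0.
by move: E; rewrite qE => /eqP; rewrite eqseq_cat // eqxx => /eqP.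
Qed.

Lemma code_rcons R x a :
  right_ideal R -> ~ R x -> R (rcons x a) -> code R (rcons x a).
Proof.
move=> rR nRx Rxa; split=> // q w; case/lastP: w => // w b.
by rewrite -rcons_cat => /rcons_inj[xE _] Rq; case: nRx; rewrite xE; apply: rR.
Qed.

(** Otherwise every extension of [x] outside [R] could be prolonged by one letter and stay outside,
    giving arbitrarily long words outside [R]. *)
Lemma caret R x : fg_essential R -> ~ R x ->
  exists w, ~ R (x ++ w) /\ forall a, R (rcons (x ++ w) a).
Proof.
move=> /fg_essentialP[_ _ [N lR]] nRx; apply: contrapT => H.
suff /(_ N)[w [sw]] : forall n, exists w, size w = n /\ ~ R (x ++ w).
  by apply; apply: lR; rewrite size_cat sw leq_addl.
elim=> [|n [w [sw nR]]]; first by exists [::]; rewrite cats0.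
have [a nRa] : exists a, ~ R (rcons (x ++ w) a).
  by apply: contrapT => /forallNP Ha; apply: H; exists w; split=> // a; apply: contrapT.
by exists (rcons w a); rewrite size_rcons sw -rcons_cat.
Qed.

Definition code_involution R (s : word -> word) :=
  forall p, code R p -> code R (s p) /\ s (s p) = p.

(** The factorization of [x] is picked by choice; by [code_uniq] it is unique, so the value does not
    depend on the choice. *)
Definition permute_fun R (s : word -> word) (x : word) : option word :=
  if pselect (exists pw, code R pw.1 /\ x = pw.1 ++ pw.2) is left h
  then Some (s (sval (cid h)).1 ++ (sval (cid h)).2) else None.

Lemma permute_fun_cat R s p w :
  code R p -> permute_fun R s (p ++ w) = Some (s p ++ w).
Proof.
move=> cp; rewrite /permute_fun; case: pselect => [h|[]]; last by exists (p, w).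
by case: cid => -[q v] /= [cq /(code_uniq cp cq)[-> ->]].
Qed.

Lemma permute_funP R s x y : permute_fun R s x = Some y ->
  exists p w, [/\ code R p, x = p ++ w & y = s p ++ w].
Proof.
rewrite /permute_fun; case: pselect => // h [<-].
by case: cid => -[p w] /= [cp xE]; exists p, w.
Qed.

Lemma dom_permute_fun R s : right_ideal R -> dom (permute_fun R s) = R.
Proof.
move=> rR; apply/seteqP; split=> x.
  by move=> [y /permute_funP[p [w [[Rp _] -> _]]]]; apply: rR.
by move=> /code_prefix[p [w [cp ->]]]; exists (s p ++ w); apply: permute_fun_cat.
Qed.

Lemma permute_funK R s x y : code_involution R s ->
  permute_fun R s x = Some y -> permute_fun R s y = Some x.
Proof.
move=> Hs /permute_funP[p [w [cp -> ->]]].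
by have [csp sK] := Hs _ cp; rewrite permute_fun_cat ?sK.
Qed.

Lemma is_riAut_permute R s :
  fg_essential R -> code_involution R s -> is_riAut (permute_fun R s).
Proof.
move=> eR Hs; have [rR _ _] := (fg_essentialP R).1 eR.
have dE := dom_permute_fun s rR; split; first by rewrite dE.
- suff -> : ran (permute_fun R s) = dom (permute_fun R s) by rewrite dE.
  by apply/seteqP; split=> y [x /(permute_funK Hs) fy]; exists x.
- by move=> x x' y /(permute_funK Hs) + /(permute_funK Hs) => -> [].
- move=> x w y /permute_funP[p [v [cp -> ->]]].
  by rewrite -!catA permute_fun_cat.
Qed.

Definition permute (R : fgeri A) s (Hs : code_involution R s) : riAut A :=
  RiAut (asboolT (is_riAut_permute (fgeriP R) Hs)).

Lemma fgeri_right_ideal (R : fgeri A) : right_ideal R.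
Proof. by have [rR _ _] := (fg_essentialP R).1 (fgeriP R). Qed.

Lemma permute_cat (R : fgeri A) s (Hs : code_involution R s) p w :
  code R p -> permute Hs (p ++ w) = Some (s p ++ w).
Proof. exact: permute_fun_cat. Qed.

Lemma permuteE (R : fgeri A) s (Hs : code_involution R s) p :
  code R p -> permute Hs p = Some (s p).
Proof. by move=> /(permute_cat Hs [::]); rewrite !cats0. Qed.

Lemma Dom_permute (R : fgeri A) s (Hs : code_involution R s) :
  Dom (permute Hs) = R.
Proof.
by apply: fgeri_inj; apply: dom_permute_fun; apply: fgeri_right_ideal.
Qed.

Lemma riAut_cat (f : riAut A) x y w : f x = Some y -> f (x ++ w) = Some (y ++ w).
Proof. by have [_ _ _] := riAutP f; apply. Qed.

Lemma mul_riAut_some (g f : riAut A) x y : f x = Some y -> (g * f) x = g y.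
Proof. by move=> fx; rewrite /= /pcomp2 fx. Qed.

(** Maps that agree on [code R] agree on [R]. Every word has an extension in [R], and a common
    suffix can be cancelled, so the maximal extension is determined by the values on [R]. *)
Lemma eta_eq_code R (f g : riAut A) : fg_essential R ->
  (forall p, code R p -> exists2 y, f p = Some y & g p = Some y) ->
  eta f = eta g.
Proof.
move=> /fg_essentialP[rR dR _].
suff H (f1 f2 : riAut A) : (forall p, code R p -> exists2 y, f1 p = Some y & f2 p = Some y) ->
    extends (max_ext f1) (max_ext f2).
  move=> E; apply: val_inj; apply: riAut_ext => x y; split; apply: H => // p.
  by move=> /E[z ? ?]; exists z.
move=> E x y /max_extE Hf; apply/max_extE => w z gxw.
have [v /code_prefix[p [u [cp pE]]]] := dR (x ++ w).
have [y' fp gp] := E _ cp.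
have := Hf (w ++ v) (y' ++ u); rewrite catA pE (riAut_cat u fp) => /(_ erefl).
have := riAut_cat v gxw; rewrite pE (riAut_cat u gp) => -[->].
by rewrite catA => /catIr.
Qed.

Lemma eta_permuteK (R : fgeri A) s (Hs : code_involution R s) :
  eta (permute Hs) * eta (permute Hs) = 1.
Proof.
rewrite -gmulfM; have <- : @eta A 1 = 1 by apply: gmulf1.
apply: (eta_eq_code (fgeriP R)) => p cp.
have [csp sK] := Hs _ cp.
by exists p => //; rewrite (mul_riAut_some _ (permuteE Hs cp)) permuteE // sK.
Qed.

Section CaretSwap.
Variables (R : fgeri A) (a0 a1 : A).

(** Reversal exposes the last letter. When [p] is in [code R], its parent lies outside [R], so the
    test says exactly that the whole caret of [p] is contained in [code R]. *)
Definition caret_swap (p : word) : word :=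
  if rev p is a :: q
  then if `[< forall b, ideal_set R (rcons (rev q) b) >]
       then rcons (rev q) (if a == a0 then a1 else if a == a1 then a0 else a)
       else p
  else p.

Lemma caret_swap_rcons q a : caret_swap (rcons q a) =
  if `[< forall b, ideal_set R (rcons q b) >]
  then rcons q (if a == a0 then a1 else if a == a1 then a0 else a)
  else rcons q a.
Proof. by rewrite /caret_swap rev_rcons revK. Qed.

Lemma caret_swap_involution : code_involution R caret_swap.
Proof.
move=> p; case/lastP: p => // p a [Rpa mp]; rewrite caret_swap_rcons.
case: asboolP => [Rp|nRp]; last first.
  by rewrite caret_swap_rcons; case: asboolP.
rewrite caret_swap_rcons; case: asboolP => // _; split.
  apply: code_rcons => //; first exact: fgeri_right_ideal.
  by move=> /(mp _ [:: a]); rewrite cats1 => /(_ erefl).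
congr rcons; case: (eqVneq a a0) => [->|n0].
  by rewrite eqxx; case: eqVneq.
by case: (eqVneq a a1) => [->|n1]; rewrite ?eqxx // (negPf n0) (negPf n1).
Qed.

(** An extension defined at some [x] outside [R] would preserve the last letter of every proper
    extension of [x]. But below [x] there is a caret contained in [code R], where the last letters
    [a0] and [a1] are exchanged. *)
Lemma Dom_eta_caret_swap :
  a0 != a1 -> Dom (eta (permute caret_swap_involution)) = R.
Proof.
move=> a01; rewrite -[RHS](Dom_permute caret_swap_involution).
apply: fgeri_inj; apply/seteqP; split=> x [y]; last first.
  by move/extends_max => h; exists y.
move=> /max_extE m; apply: contrapT => nRx.
have {}nRx : ~ ideal_set R x by move=> Rx; apply: nRx; rewrite Dom_permute.
have [w [nRw Rw]] := caret (fgeriP R) nRx.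
have := m (rcons w a0) (rcons (x ++ w) a1).
rewrite -rcons_cat permuteE; last exact: (code_rcons (@fgeri_right_ideal R) nRw).
rewrite caret_swap_rcons asboolT // eqxx => /(_ erefl).
by rewrite -rcons_cat => /rcons_inj[_ /esym/eqP]; apply/negP.
Qed.

End CaretSwap.

Lemma Dom_involution (a0 a1 : A) (R : fgeri A) : a0 != a1 ->
  exists h : thompson A, h * h = 1 /\ Dom h = R.
Proof.
move=> a01; exists (eta (permute (@caret_swap_involution R a0 a1))).
by split; [apply: eta_permuteK|apply: Dom_eta_caret_swap].
Qed.

(** * Generating sets of monoids *)

Lemma submonoid_generates_setT (M : monoidType) (X : set M) (Y : set M) :
  submonoid Y -> X `<=` Y -> generates X -> Y = setT.
Proof.
move=> sY XY gX; apply/seteqP; split=> // x _.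
by apply: (smallest_sub sY XY); rewrite -/(generated_submonoid X) gX.
Qed.

Lemma generated_submonoid_sub (M : monoidType) (X : set M) :
  X `<=` generated_submonoid X.
Proof. exact: sub_smallest. Qed.

Lemma generates_eta (D : set (riAut A)) : generates D -> generates (@eta A @` D).
Proof.
move=> gD; have [h1 hM] := submonoid_generated (@eta A @` D).
have E := @submonoid_generates_setT _ D (@eta A @^-1` generated_submonoid (@eta A @` D)).
apply/seteqP; split=> // g _; rewrite -(eta_maxmap g).
have : setT (maxmap g) by []; rewrite -E //.
- split=> [|f1 f2 e1 e2]; rewrite /preimage /= ?gmulf1 ?gmulfM //.
  exact: hM.
- by move=> d Dd; apply: generated_submonoid_sub; exists d.
Qed.

Lemma generates_setT (M : monoidType) : generates [set: M].
Proof. by apply/seteqP; split=> // x _; apply: generated_submonoid_sub. Qed.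

Lemma generates_subset (M : monoidType) (X Y : set M) :
  X `<=` Y -> generates X -> generates Y.
Proof.
move=> XY; apply: submonoid_generates_setT; first exact: submonoid_generated.
by apply: subset_trans XY _; apply: generated_submonoid_sub.
Qed.

(** The images under [eta] generate, but [eta] may enlarge domains. Adding for each [d] one
    involution with domain [Dom d] supplies the missing domains and accounts for the factor 2. *)
Lemma exists_generating_surj_condition_wrt (a0 a1 : A) (Delta : set (riAut A)) :
  a0 != a1 -> generates Delta ->
  exists Gamma : set (thompson A),
    [/\ generates Gamma, surj_condition_wrt Gamma Delta
      & finite_set Delta -> finite_set Gamma /\
          (#|` fset_set Gamma| <= 2 * #|` fset_set Delta|)%N].
Proof.
move=> a01 gD; pose h d := sval (cid (Dom_involution (Dom d) a01)).
exists (@eta A @` Delta `|` h @` Delta); split.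
- exact: generates_subset (@subsetUl _ _ _) (generates_eta gD).
- move=> d Dd; exists (h d); first by right; exists d.
  by rewrite /h; case: cid => g [].
move=> fD; have fe := finite_image (@eta A) fD; have fh := finite_image h fD.
split; first by rewrite finite_setU.
rewrite fset_setU // mul2n -addnn (leq_trans (leq_card_fsetU _ _).1) //.
by rewrite !fset_set_image // leq_add // leq_imfset_card.
Qed.

End Codes.

(** * Necessity and failure of the surjectiveness condition *)

Section Generation.
Variable A : finType.
Local Notation word := (seq A).
Implicit Types (R : fgeri A) (p q u v w x y : word).

(** Since [Dom 1] is everything, [rho] sends the generator of [g] to [embed g]. Values of [rho] are
    therefore embedded products of elements of [G], and [embed] is injective. *)
Lemma surj_rho_generates (G : set (thompson A)) :
  set_surj [set: suffix_expansion G] (range (@embed A)) (@rho A G) ->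
  generates (@maxmap A @` G).
Proof.
move=> rhoS; apply/seteqP; split=> // f _.
have [p _ pf] := rhoS (embed f) (imageT _ f).
have [h1 hM] := submonoid_generated (@maxmap A @` G).
pose Y : set (suffix_pair (thompson A)) := [set q | exists2 s : suffix_expansion G,
  suffix_val s = q & exists2 d, generated_submonoid (@maxmap A @` G) d &
    embed d = rho s].
have /asboolP gp := valP p.
have : Y (suffix_val p).
  apply: smallest_sub gp; first split.
  - by exists 1 => //; exists 1 => //; rewrite rho1.
  - move=> _ _ [s <- [d Dd ds]] [t <- [e De et]].
    by exists (s * t) => //; exists (d * e); [apply: hM|rewrite embed_mul ds et rho_mul].
  move=> _ [g Gg <-].
  have sg : in_suffix_expansion G (suffix_generator g).
    by apply/asboolP; apply: generated_submonoid_sub; exists g.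
  exists (SuffixExpansion sg) => //; exists (maxmap g).
    by apply: generated_submonoid_sub; exists g.
  congr pair; first exact: eta_maxmap.
  apply: fgeri_inj; apply/seteqP; split=> x /=.
    move=> gx h; rewrite /= !inE => /orP[] /eqP -> //.
    by exists x; apply: one_thompsonE.
  by apply; rewrite /= !inE eqxx.
move=> [s /val_inj-> [d Dd]]; rewrite pf => /embed_inj <- //.
Qed.

Section TwoLetters.
Variables (a0 a1 : A).
Hypothesis a01 : a0 != a1.

Lemma other_letter (a : A) : exists b, b != a.
Proof.
by case: (eqVneq a0 a) => [<-|]; [exists a1; rewrite eq_sym|exists a0].
Qed.

(** Such an [f] is prefixing by [y]. If [y] began with a letter [c], the range would miss all words
    beginning with another letter and would not be essential. *)
Lemma riAut_nil (f : riAut A) y : f [::] = Some y -> f = 1.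
Proof.
move=> f0; have fE x : f x = Some (y ++ x) by have := riAut_cat x f0.
case: y fE {f0} => [|c y] fE.
  by apply: riAut_ext => x z; rewrite fE.
have [_ /fg_essentialP[_ + _] _ _] := riAutP f.
have [b bc] := other_letter c.
by move=> /(_ [:: b])[w [x]]; rewrite fE => -[cb]; rewrite cb eqxx in bc.
Qed.

Lemma thompson_nil (g : thompson A) y : g [::] = Some y -> g = 1.
Proof. by move=> /riAut_nil E; rewrite -(eta_maxmap g) E gmulf1. Qed.

Lemma fg_essential_long N : fg_essential [set x : word | N <= size x].
Proof.
apply/fg_essentialP; split.
- by move=> x w /= Nx; rewrite size_cat (leq_trans Nx (leq_addr _ _)).
- by move=> x; exists (nseq N a0); rewrite /= size_cat size_nseq leq_addl.
- by exists N.
Qed.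

Definition long N : fgeri A := mk_fgeri (fg_essential_long N).

(** Let [g * f] have domain [long 1]. If [f] is defined at the empty word it is 1, and [g] has that
    domain. Otherwise [Dom f] consists of nonempty words and contains [long 1]. *)
Lemma Dom_long1_submonoid : submonoid [set f : riAut A | Dom f <> long 1].
Proof.
split=> [|g f Hg Hf /= E].
  move=> /(congr1 (fun R : fgeri A => ideal_set R [::])) E.
  by have : dom (1 : riAut A) [::]; [exists [::]|rewrite /= in E; rewrite E].
case f0: (f [::]) => [y|].
  by move: E; rewrite (riAut_nil f0) mulg1.
apply: Hf; apply: fgeri_inj; apply/seteqP; split=> x /=.
  by case: x => // -[y]; rewrite f0.
move=> sx; have : ideal_set (Dom (g * f)) x by rewrite E.
by move=> [z /mul_riAutE[y fx _]]; exists y.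
Qed.

(** Otherwise [D] would lie in the submonoid of [Dom_long1_submonoid], which is proper because some
    involution has domain [long 1]. *)
Lemma surj_condition_long1 (G : set (thompson A)) :
  surj_condition G -> exists2 g, G g & Dom g = long 1.
Proof.
move=> [D gD DG]; apply: contrapT => nG.
have E : [set f : riAut A | Dom f <> long 1] = setT.
  apply: submonoid_generates_setT Dom_long1_submonoid _ gD => d /DG[g Gg dg] /= dE.
  by apply: nG; exists g; rewrite // -dg.
have [h [_ hE]] := Dom_involution (long 1) a01.
have : setT (maxmap h) by [].
by rewrite -E => /(_ hE).
Qed.

Lemma generates_Dom_long1 : generates [set g : thompson A | Dom g <> long 1].
Proof.
apply/seteqP; split=> // g _.
have [h1 hM] := submonoid_generated [set g : thompson A | Dom g <> long 1].
have [gE|gE] := pselect (Dom g = long 1); last exact: generated_submonoid_sub.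
have [y gy] : ideal_set (Dom g) [:: a0] by rewrite gE.
(* The bound exceeds both the length 1 of [[:: a0]] and the length of its image [y], so neither [h]
   nor [h * g] is defined at [[:: a0]]. Then [g] is the product of [h] and [h * g]. *)
have [h [hh hE]] := Dom_involution (long (size y).+2) a01.
rewrite -[g]mul1g -hh -mulgA; apply: (hM); apply: generated_submonoid_sub => /= E.
  have : ideal_set (long (size y).+2) [:: a0] by rewrite -hE E.
  by [].
have : ideal_set (Dom (h * g)) [:: a0] by rewrite E.
move=> [z]; rewrite (mul_thompson_def _ _ gy) => hy.
have : ideal_set (long (size y).+2) y by rewrite -hE; exists z.
by rewrite /= ltnNge leqnSn.
Qed.

End TwoLetters.

(** * Swaps of two code words *)

Definition transpose u v p := if p == u then v else if p == v then u else p.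

Lemma transposeL u v : transpose u v u = v.
Proof. by rewrite /transpose eqxx. Qed.

Lemma transposeR u v : transpose u v v = u.
Proof. by rewrite /transpose eqxx; case: eqVneq. Qed.

Lemma transposeD u v p : p != u -> p != v -> transpose u v p = p.
Proof. by rewrite /transpose => /negPf -> /negPf ->. Qed.

Lemma transpose_involution (R : set word) u v :
  code R u -> code R v -> code_involution R (transpose u v).
Proof.
move=> cu cv p cp; rewrite /transpose; case: (eqVneq p u) => [->|pu].
  by split=> //; rewrite eqxx; case: eqVneq.
case: (eqVneq p v) => [->|pv]; first by rewrite eqxx.
by rewrite (negPf pu) (negPf pv).
Qed.

Lemma exists_words_below N : exists s : seq word, forall x, size x <= N -> x \in s.
Proof.
elim: N => [|N [s sP]]; first by exists [:: [::]] => -[].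
exists ([::] :: [seq a :: x | a <- enum A, x <- s]) => -[|a x] // sx.
by rewrite inE /= allpairs_f ?mem_enum // sP.
Qed.

Lemma code_image (f : riAut A) p y :
  code (dom f) p -> f p = Some y -> code (ran f) y.
Proof.
move=> [_ mp] fp; split=> [|q w yE [x fx]]; first by exists p.
have [_ _ inj _] := riAutP f.
apply: (mp x w); last by exists q.
by apply: inj fp _; rewrite yE; apply: riAut_cat.
Qed.

Lemma fg_essential_ran (f : riAut A) : fg_essential (ran f).
Proof. by have [] := riAutP f. Qed.

Definition Ran f : fgeri A := mk_fgeri (fg_essential_ran f).

Section TwoLetterAlphabet.
Variables (a0 a1 : A).
Hypothesis a01 : a0 != a1.
Hypothesis letters : forall a, a = a0 \/ a = a1.

(** Deleting [u] and [v] replaces them in the code by the carets below them. A right ideal remains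
    because no word of [R] is a proper prefix of a code word. *)
Lemma fg_essential_remove R u v : code R u -> code R v ->
  fg_essential [set x | [/\ ideal_set R x, x <> u & x <> v]].
Proof.
move=> [Ru mu] [Rv mv]; have [rR dR [N lR]] := (fg_essentialP R).1 (fgeriP R).
have lR' x : N + size u + size v < size x -> [/\ ideal_set R x, x <> u & x <> v].
  move=> sx; split.
  - by apply: lR; apply: leq_trans (ltnW sx); rewrite -addnA leq_addr.
  - by move=> E; move: sx; rewrite E ltnNge addnAC leq_addl.
  - by move=> E; move: sx; rewrite E ltnNge leq_addl.
apply/fg_essentialP; split; last by exists (N + size u + size v).+1.
- move=> x w [Rx xu xv]; split; first exact: rR.
    by move=> E; have w0 := mu _ _ (esym E) Rx; rewrite w0 cats0 in E.
  by move=> E; have w0 := mv _ _ (esym E) Rx; rewrite w0 cats0 in E.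
- move=> x; exists (nseq (N + size u + size v).+1 a0); apply: lR'.
  by rewrite size_cat size_nseq leq_addl.
Qed.

Definition remove R u v (cu : code R u) (cv : code R v) : fgeri A :=
  mk_fgeri (fg_essential_remove cu cv).

Section Remove.
Variables (R : fgeri A) (u v : word) (cu : code R u) (cv : code R v).

Lemma code_remove_rcons a :
  code (remove cu cv) (rcons u a) /\ code (remove cu cv) (rcons v a).
Proof.
have rR := @fgeri_right_ideal _ R; have rR' := @fgeri_right_ideal _ (remove cu cv).
have [Ru mu] := cu; have [Rv mv] := cv.
have rconsN x : rcons x a <> x.
  by move=> /(congr1 size); rewrite size_rcons => /eqP; rewrite gtn_eqF.
split; apply: code_rcons => //.
- by case.
- split; [by rewrite -cats1; apply: rR|exact: rconsN|].
  by rewrite -cats1 => E; have := mv _ _ (esym E) Ru.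
- by case.
- split; [by rewrite -cats1; apply: rR| |exact: rconsN].
  by rewrite -cats1 => E; have := mu _ _ (esym E) Rv.
Qed.

Lemma code_removeP p : code (remove cu cv) p ->
  [\/ exists a, p = rcons u a, exists a, p = rcons v a
    | [/\ code R p, p != u & p != v]].
Proof.
move=> cp; have [[Rp pu pv] mp] := cp.
have [q [w [cq pE]]] := code_prefix Rp.
have aux x : p = x ++ w -> p <> x ->
    (forall a, code (remove cu cv) (rcons x a)) -> exists a, p = rcons x a.
  move=> {}pE px cx; case: w pE => [|a w] pE; first by rewrite cats0 in pE.
  have E : p ++ [::] = rcons x a ++ w by rewrite cats0 pE cat_rcons.
  by exists a; have [] := code_uniq cp (cx a) E.
have [qu|qu] := eqVneq q u.
  by apply: Or31; rewrite qu in pE; apply: aux => // a; have [] := code_remove_rcons a.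
have [qv|qv] := eqVneq q v.
  by apply: Or32; rewrite qv in pE; apply: aux => // a; have [] := code_remove_rcons a.
suff w0 : w = [::] by apply: Or33; rewrite pE w0 cats0; split.
by apply: mp pE _; case: cq => Rq _; split=> //; apply/eqP.
Qed.

End Remove.

Definition swap R u v (cu : code R u) (cv : code R v) : thompson A :=
  eta (permute (transpose_involution cu cv)).

Definition cube_roots1 : set (thompson A) := [set g | g * g * g = 1].

Local Notation generated := (generated_submonoid cube_roots1).

(** The product is a 3-cycle of code words: [v] goes to [w], [w] to [u] and [u] to [v]. Its cube
    fixes every code word. *)
Lemma generated_swap_swap R u v w (cu : code R u) (cv : code R v) (cw : code R w) :
  u <> v -> v <> w -> u <> w -> generated (swap cu cv * swap cv cw).
Proof.
move=> /eqP uv /eqP vw /eqP uw; apply: generated_submonoid_sub.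
rewrite /cube_roots1 /= /swap.
set H1 := transpose_involution cu cv; set H2 := transpose_involution cv cw.
set f := permute H1 * permute H2.
have -> : eta (permute H1) * eta (permute H2) = eta f by rewrite gmulfM.
have -> : eta f * eta f * eta f = eta (f * f * f) by rewrite !gmulfM.
have <- : @eta A 1 = 1 by apply: gmulf1.
apply: (eta_eq_code (fgeriP R)) => p cp; exists p => //.
have c1 q : code R q -> code R (transpose u v q) by move=> /H1[].
have c2 q : code R q -> code R (transpose v w q) by move=> /H2[].
have E q : code R q -> f q =
    Some (transpose u v (transpose v w q)).
  by move=> cq; rewrite (mul_riAut_some _ (permuteE H2 cq)) permuteE //; apply: c2.
rewrite -mulgA (mul_riAut_some _ (y := transpose u v (transpose v w
  (transpose u v (transpose v w p))))); last first.
  by rewrite (mul_riAut_some _ (E _ cp)) E //; apply/c1/c2.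
rewrite E; last by do 2 apply/c1/c2.
have [wu wv uv'] : [/\ w != u, w != v & u != v] by rewrite !(eq_sym w).
congr Some; have [->|pv] := eqVneq p v.
  by rewrite transposeL (transposeD wu wv) !transposeR (transposeD uv uw) transposeL.
have [->|pw] := eqVneq p w.
  by rewrite !transposeR (transposeD uv uw) !transposeL transposeD.
have [->|pu] := eqVneq p u.
  by rewrite (transposeD uv uw) !transposeL (transposeD wu wv) !transposeR.
by rewrite !transposeD.
Qed.

Lemma swapK R u v (cu : code R u) (cv : code R v) : swap cu cv * swap cu cv = 1.
Proof. exact: eta_permuteK. Qed.

(** Exchanging the prefixes [u] and [v] keeps the next letter, which is [a0] or [a1]. On the refined
    code the swap thus splits into one transposition per letter. *)
Lemma swap_remove R u v (cu : code R u) (cv : code R v)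
    (cu0 : code (remove cu cv) (rcons u a0)) (cv0 : code (remove cu cv) (rcons v a0))
    (cu1 : code (remove cu cv) (rcons u a1)) (cv1 : code (remove cu cv) (rcons v a1)) :
  u <> v -> swap cu cv = swap cu0 cv0 * swap cu1 cv1.
Proof.
move=> uv; rewrite /swap -gmulfM.
apply: (eta_eq_code (fgeriP (remove cu cv))) => p cp.
have neq x y b c : x != y \/ b != c -> rcons x b != rcons y c.
  by rewrite eqseq_rcons negb_and => H; apply/orP.
have uv' : u != v by apply/eqP.
have vu' : v != u by rewrite eq_sym.
have a10 : a1 != a0 by rewrite eq_sym.
exists (transpose (rcons u a0) (rcons v a0) (transpose (rcons u a1) (rcons v a1) p));
  last first.
  rewrite (mul_riAut_some _ (permuteE _ cp)) permuteE //.
  by have [] := transpose_involution cu1 cv1 cp.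
case: (code_removeP cp) => [[a ->]|[a ->]|[cp' pu pv]].
- rewrite -cats1 permute_cat // !cats1 transposeL.
  case: (letters a) => ->; last by rewrite transposeL transposeD; auto.
  by rewrite [transpose (rcons u a1) _ _]transposeD ?transposeL; auto.
- rewrite -cats1 permute_cat // !cats1 transposeR.
  case: (letters a) => ->; last by rewrite transposeR transposeD; auto.
  by rewrite [transpose (rcons u a1) _ _]transposeD ?transposeR; auto.
- rewrite permuteE // transposeD //; congr Some.
  have H x a : code R x -> p != x -> p != rcons x a.
    move=> [Rx mx] px; apply/eqP => pE; have [_ mp] := cp'.
    by have := mp x [:: a]; rewrite cats1 => /(_ pE Rx).
  by rewrite !transposeD ?H.
Qed.

Lemma generated_swap R u v (cu : code R u) (cv : code R v) : generated (swap cu cv).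
Proof.
have [h1 hM] := submonoid_generated cube_roots1.
have [uv|uv] := pselect (u = v).
  suff -> : swap cu cv = 1 by [].
  rewrite /swap; have <- : @eta A 1 = 1 by apply: gmulf1.
  apply: (eta_eq_code (fgeriP R)) => p cp; exists p => //.
  by rewrite permuteE // /transpose uv; case: eqVneq => [->|].
have [cu0 cv0] := code_remove_rcons cu cv a0.
have [cu1 cv1] := code_remove_rcons cu cv a1.
rewrite (swap_remove cu0 cv0 cu1 cv1 uv).
(* Inserting the square of the swap of [v a0] and [u a1] turns the product of two disjoint
   transpositions into a product of two 3-cycles. *)
have <- : swap cv0 cu1 * (swap cv0 cu1 * swap cu1 cv1) = swap cu1 cv1.
  by rewrite mulgA swapK mul1g.
have /eqP a01' := a01.
have N w w' b c : w <> w' \/ b <> c -> rcons w b <> rcons w' c.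
  by move=> H /rcons_inj[ww bc]; case: H.
rewrite mulgA; apply: hM; apply: generated_swap_swap; apply: N; auto.
Qed.

End TwoLetterAlphabet.

End Generation.

(** * Two letters: generation by the solutions of $g^3=1$ *)

Section LetterSwap.
Variable A : finType.
Local Notation word := (seq A).
Implicit Types (R : fgeri A) (p q u v w x y : word).

Section TwoLetterAlphabet.
Variables (a0 a1 : A).
Hypothesis a01 : a0 != a1.
Hypothesis letters : forall a, a = a0 \/ a = a1.

Lemma permute_total R s (Hs : code_involution R s) y : ideal_set R y ->
  exists2 z, permute Hs y = Some z & ideal_set R z.
Proof.
move=> /code_prefix[p [w [cp ->]]]; exists (s p ++ w); first exact: permute_cat.
by apply: fgeri_right_ideal; have [[]] := Hs _ cp.
Qed.

Lemma etaM : {morph @eta A : f g / f * g}.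
Proof. exact: gmulfM. Qed.

(** Induction on the length of a list containing all words outside the domain. Composing with two
    swaps carries the images of a caret below [t] to a caret below [r], so that the maximal
    extension becomes defined at [t]. *)
Lemma generates_cube_roots1 : generates (@cube_roots1 A).
Proof.
have [h1 hM] := submonoid_generated (@cube_roots1 A).
suff H n : forall (g : thompson A) (s : seq word), size s < n ->
    (forall x, ~ dom g x -> x \in s) -> generated_submonoid (@cube_roots1 A) g.
  apply/seteqP; split=> // g _.
  have [_ _ [N lg]] := (fg_essentialP _).1 (fgeriP (Dom g)).
  have [s sP] := exists_words_below A N.
  apply: (H _ g s (ltnSn _)) => x nx; apply: sP.
  by rewrite leqNgt; apply/negP => /ltnW /lg.
elim: n => // n IH g s; rewrite ltnS => sn sP.
case g0: (g [::]) => [y|]; first by rewrite (thompson_nil a01 g0).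
have nd0 : ~ ideal_set (Dom g) [::] by move=> [y]; rewrite g0.
have nr0 : ~ ideal_set (Ran g) [::].
  move=> [x /(pinvE _ _ (riAutP g)) gx].
  have E := @riAut_nil _ _ _ a01 (inv_riAut g) _ gx.
  have : inv_riAut g [::] = Some [::] by rewrite E.
  by move=> /(pinvE _ _ (riAutP g)); rewrite g0.
have [t [/= nt tP]] := caret (fgeriP (Dom g)) nd0.
have [r [/= nr rP]] := caret (fgeriP (Ran g)) nr0.
have ct a := code_rcons (@fgeri_right_ideal _ (Dom g)) nt (tP a).
have cr a := code_rcons (@fgeri_right_ideal _ (Ran g)) nr (rP a).
have [u gu] := tP a0; have [v gv] := tP a1.
have cu : code (Ran g) u := code_image (ct a0) gu.
have cv : code (Ran g) v := code_image (ct a1) gv.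
have uv : u <> v.
  move=> uv; have [_ _ inj _] := riAutP g.
  move: gv; rewrite -uv => /(inj _ _ _ gu) /rcons_inj[/eqP].
  by rewrite (negPf a01).
have [cv' v'K] := transpose_involution cu (cr a0) cv.
(* The first swap, of [u] and [r a0], may already move [v]; the second swap has to start from the
   new position [v']. *)
set v' := transpose _ _ _ in cv' v'K.
have r0v' : rcons r a0 != v'.
  by apply/eqP => E; apply: uv; rewrite -v'K -E transposeR.
have r01 : rcons r a0 != rcons r a1 by rewrite eqseq_rcons eqxx.
pose k1 := transpose_involution cu (cr a0); pose k2 := transpose_involution cv' (cr a1).
pose f := permute k2 * (permute k1 * g).
have ft0 : f (rcons t a0) = Some (rcons r a0).
  rewrite (mul_riAut_some _ (y := rcons r a0)) ?permuteE ?transposeD //.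
  by rewrite (mul_riAut_some _ gu) permuteE // transposeL.
have ft1 : f (rcons t a1) = Some (rcons r a1).
  rewrite (mul_riAut_some _ (y := v')) ?permuteE ?transposeL //.
  by rewrite (mul_riAut_some _ gv) permuteE.
have gE : eta f = swap cv' (cr a1) * (swap cu (cr a0) * g).
  by rewrite /f etaM etaM eta_maxmap.
have -> : g = swap cu (cr a0) * (swap cv' (cr a1) * eta f).
  by rewrite gE (mulgA (swap cv' _)) swapK mul1g mulgA swapK mul1g.
have gs := generated_swap a01 letters.
apply: (hM); first exact: gs.
apply: (hM); first exact: gs.
have ts : t \in s by apply: sP.
apply: (IH _ [seq x <- s | x != t]).
  apply: leq_trans sn; rewrite size_filter -(count_predC (pred1 t) s).
  by rewrite -[X in X < _]add0n ltn_add2r -has_count has_pred1.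
move=> x nx; rewrite mem_filter; apply/andP; split.
  apply/eqP => xt; apply: nx; rewrite xt; exists r.
  (* The composite is undefined at [t] itself, so the condition is vacuous for the empty suffix; the
     other suffixes begin with one of the two letters of the caret. *)
  apply/max_extE => -[|a w] z.
    by rewrite cats0 => /mul_riAutE[y /mul_riAutE[y' gt _] _]; case: nt; exists y'.
  rewrite -!cat_rcons.
  by case: (letters a) => ->; [rewrite (riAut_cat w ft0)|rewrite (riAut_cat w ft1)] => -[].
(* Both swaps are defined on all of [Ran g], so no word of the old domain is lost. *)
apply: sP => -[y gx]; apply: nx.
have [z1 e1 Rz1] := permute_total k1 (ex_intro _ x gx : ideal_set (Ran g) y).
have [z2 e2 _] := permute_total k2 Rz1.
exists z2; apply: extends_max.
by rewrite (mul_riAut_some _ (y := z1)) // (mul_riAut_some _ gx).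
Qed.

(** * The exchange of the two letters and its irreducibility *)

Lemma code_long1 (a : A) : code (long a0 1) [:: a].
Proof. by split=> // -[|b [|c q]] // [|d w] //=. Qed.

Definition letter_swap : riAut A :=
  permute (transpose_involution (code_long1 a0) (code_long1 a1)).

Lemma letter_swapE0 : letter_swap [:: a0] = Some [:: a1].
Proof. by rewrite permuteE ?transposeL //; apply: code_long1. Qed.

Lemma letter_swapE1 : letter_swap [:: a1] = Some [:: a0].
Proof. by rewrite permuteE ?transposeR //; apply: code_long1. Qed.

Lemma letter_swap_nil : letter_swap [::] = None.
Proof.
case E: (letter_swap _) => [y|//].
have : ideal_set (Dom letter_swap) [::] by exists y.
by rewrite Dom_permute.
Qed.

Lemma riAut_eq_letters (f g : riAut A) : f [::] = None -> g [::] = None ->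
  (forall a, exists2 y, f [:: a] = Some y & g [:: a] = Some y) -> f = g.
Proof.
move=> f0 g0 fg; apply: riAut_ext => -[|a x] y; first by rewrite f0 g0.
by have [z fa ga] := fg a; rewrite -cat1s (riAut_cat x fa) (riAut_cat x ga).
Qed.

(** The two images form a maximal prefix code, and a two-word maximal prefix code over two letters
    consists of the letters. *)
Lemma image_letter (f : riAut A) (y : A -> word) : f [::] = None ->
  (forall a, f [:: a] = Some (y a)) -> forall a, exists b, y a = [:: b].
Proof.
move=> f0 fy.
have [_ /fg_essentialP[_ df _] inj _] := riAutP f.
have incomp b c w : y b = y c ++ w -> b = c.
  by move=> E; have := riAut_cat w (fy c); rewrite -E => /(inj _ _ _ (fy b))[].
have yN0 b : y b <> [::].
  have [c cb] := other_letter a01 b.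
  by move=> yb; have := @incomp c b (y c); rewrite yb => /(_ erefl) E; rewrite E eqxx in cb.
have cover x : exists b w w', x ++ w = y b ++ w'.
  have [w [[|b z] fz]] := df x; first by rewrite f0 in fz.
  exists b, w, z; move: fz; rewrite -cat1s (riAut_cat z (fy b)) => -[] //.
move=> b; case yb: (y b) (yN0 b) => [//|c q] _; case/lastP: q yb => [|q d] yb.
  by exists c.
have [c' c'c] := other_letter a01 c; have [d' d'd] := other_letter a01 d.
(* If an image has the form [c q d], neither [c'] nor [c q d'] is prefix-comparable with it. Both
   must then be comparable with the other image, which would begin with [c'] and with [c]. *)
have [b1 [w1 [w1' E1]]] := cover [:: c'].
have [b2 [w2 [w2' E2]]] := cover (c :: rcons q d').
have b1b : b1 <> b.
  by move=> E; move: E1; rewrite E yb => -[/eqP]; rewrite (negPf c'c).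
have b2b : b2 <> b.
  move=> E; move: E2; rewrite E yb => /eqP; rewrite eqseq_cat ?size_rcons //=; last first.
    by rewrite !size_rcons.
  by rewrite eqseq_cons eqseq_rcons (negPf d'd) !andbF.
have b12 : b1 = b2.
  by case: (letters b1) (letters b2) (letters b) b1b b2b => -> [] -> [] ->.
case y1: (y b1) (yN0 b1) => [//|e q'] _.
move: E1 E2; rewrite -b12 y1 => -[<- _] [/eqP]; rewrite eq_sym (negPf c'c) //.
Qed.

(** If [f] is not 1, it is undefined at the empty word and permutes the letters. Either it exchanges
    them, or it is the identity on nonempty words and [g] has to exchange them. *)
Lemma letter_swap_irreducible (g f : riAut A) :
  g * f = letter_swap -> g = letter_swap \/ f = letter_swap.
Proof.
move=> E; case f0: (f [::]) => [y|].
  by left; rewrite -E (riAut_nil a01 f0) mulg1.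
have ex a : exists y, f [:: a] = Some y.
  case: (letters a) => ->.
    by have := letter_swapE0; rewrite -E => /mul_riAutE[y]; exists y.
  by have := letter_swapE1; rewrite -E => /mul_riAutE[y]; exists y.
pose y a := sval (cid (ex a)); have fy a : f [:: a] = Some (y a).
  by rewrite /y; case: cid.
have [b0 yb0] := image_letter f0 fy a0; have [b1 yb1] := image_letter f0 fy a1.
have b01 : b0 <> b1.
  move=> b01; have [_ _ inj _] := riAutP f; move: (fy a1) (fy a0).
  rewrite yb0 yb1 b01 => h /inj /(_ h) [aE]; by move: a01; rewrite aE eqxx.
have fa0 := fy a0; have fa1 := fy a1; rewrite yb0 in fa0; rewrite yb1 in fa1.
have ga0 := letter_swapE0; have ga1 := letter_swapE1.
rewrite -E (mul_riAut_some _ fa0) in ga0; rewrite -E (mul_riAut_some _ fa1) in ga1.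
case: (letters b0) b01 fa0 ga0 => ->; case: (letters b1) fa1 ga1 => -> // fa1 ga1 _ fa0 ga0.
- left; apply: riAut_eq_letters => [||a].
  + case g0: (g [::]) => [z|//]; move: ga0.
    by rewrite (riAut_nil a01 g0) => -[/eqP]; rewrite (negPf a01).
  + exact: letter_swap_nil.
  + by case: (letters a) => ->; [exists [:: a1]|exists [:: a0]];
      rewrite ?letter_swapE0 ?letter_swapE1.
- right; apply: riAut_eq_letters => [//||a]; first exact: letter_swap_nil.
  by case: (letters a) => ->; [exists [:: a1]|exists [:: a0]];
      rewrite ?letter_swapE0 ?letter_swapE1.
Qed.

(** * Powers of suffix generators and the missing surjection *)

Lemma suffix_generator_cube (M : monoidType) (x : M) : x * x * x = 1 ->
  let p := suffix_generator x in p * p * p * p * p = p * p.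
Proof.
move=> xxx; set p := suffix_generator x => /=.
(* From the second power on, the second component stays at this set, which is stable under right
   multiplication by [x]; the first component has period 3. *)
pose S z : suffix_pair M := (z, [fset x * x; x; 1]%fset).
have pE (q : suffix_pair M) :
    q * p = (q.1 * x, ([fset t * x | t in q.2] `|` [fset x; 1])%fset) by [].
have E z : S (z * x) = S z * p.
  rewrite pE; congr (_, _); apply/fsetP => y.
  rewrite !imfsetU !imfset_fset1 !inE mul1g xxx.
  by case: (y == x * x); case: (y == x); case: (y == 1).
have -> : p * p = S (x * x).
  rewrite pE; congr (_, _); apply/fsetP => y.
  rewrite !imfsetU !imfset_fset1 !inE mul1g.
  by case: (y == x * x); case: (y == x); case: (y == 1).
by rewrite -!E xxx mul1g.
Qed.

End TwoLetterAlphabet.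
End LetterSwap.

Lemma no_surjection_onto_riAut (B : finType) : #|B| = 2 ->
  exists2 Gamma : set (thompson B), generates Gamma &
    ~ exists2 h : suffix_expansion Gamma -> riAut B, monoid_morphism h &
        set_surj [set: suffix_expansion Gamma] [set: riAut B] h.
Proof.
move=> B2.
have [a0 [a1 [a01 letters]]] : exists a0 a1 : B, a0 != a1 /\ forall a, a = a0 \/ a = a1.
  have /cards2P[a0 [a1 [a01 BE]]] : #|[set: B]%SET| == 2 by rewrite cardsT B2.
  exists a0, a1; split=> // a.
  by have := finset.in_setT a; rewrite BE => /set2P.
exists (@cube_roots1 B); first exact: generates_cube_roots1 a01 letters.
move=> [h [h1 hM] hS].
have sw5 : letter_swap a0 a1 * letter_swap a0 a1 * letter_swap a0 a1 *
    letter_swap a0 a1 * letter_swap a0 a1 <> letter_swap a0 a1 * letter_swap a0 a1.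
  move=> /(congr1 (fun f : riAut B => f [:: a0])).
  rewrite !(mul_riAut_some _ (letter_swapE0 a0 a1), mul_riAut_some _ (letter_swapE1 a0 a1))
    letter_swapE0 letter_swapE1 => -[/eqP].
  by rewrite eq_sym (negPf a01).
have hgen g (s : suffix_expansion (@cube_roots1 B)) : cube_roots1 g ->
    suffix_val s = suffix_generator g -> h s <> letter_swap a0 a1.
  move=> g3 sE hs; apply: sw5; rewrite -hs -!hM; congr h; apply: val_inj.
  by rewrite /= sE; apply: suffix_generator_cube.
have [p _ hp] := hS (letter_swap a0 a1) I.
(* By irreducibility the elements not sent to the letter exchange form a submonoid. It contains the
   generators, so it is the whole expansion. *)
pose Y : set (suffix_pair (thompson B)) := [set q |
  exists2 s : suffix_expansion (@cube_roots1 B), suffix_val s = q & h s <> letter_swap a0 a1].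
have : Y (suffix_val p).
  have /asboolP gp := valP p; apply: smallest_sub gp; first split.
  - exists 1 => //; rewrite h1 => E; have := letter_swap_nil a0 a1.
    by rewrite -E.
  - move=> _ _ [s <- hs] [t <- ht]; exists (s * t) => //.
    by rewrite hM => /(letter_swap_irreducible a01 letters)[].
  move=> _ [g Gg <-].
  have sg : in_suffix_expansion (@cube_roots1 B) (suffix_generator g).
    by apply/asboolP; apply: generated_submonoid_sub; exists g.
  by exists (SuffixExpansion sg) => //; apply: hgen Gg _.
by move=> [s /val_inj-> ]; rewrite hp.
Qed.

Theorem proposition4p5 (k : nat) (A : finType) (hk : (2 <= k)%N) (hA : #|A| = k) :
  [/\ (forall Delta : set (riAut A), generates Delta ->
        exists Gamma : set (thompson A),
          [/\ generates Gamma,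
              surj_condition_wrt Gamma Delta
            & finite_set Delta ->
              finite_set Gamma /\
              (#|` fset_set Gamma| <= 2 * #|` fset_set Delta|)%N]),
      (generates [set: thompson A] /\ surj_condition [set: thompson A]),
      (forall Gamma : set (thompson A), generates Gamma ->
        set_surj [set: suffix_expansion Gamma] (range (@embed A)) (@rho A Gamma) ->
        surj_condition Gamma),
      (exists2 Gamma : set (thompson A), generates Gamma & ~ surj_condition Gamma)
    & (forall B : finType, #|B| = 2 ->
        exists2 Gamma : set (thompson B), generates Gamma &
          ~ exists2 h : suffix_expansion Gamma -> riAut B,
              monoid_morphism h &
              set_surj [set: suffix_expansion Gamma] [set: riAut B] h)].
Proof.
have [a0 [a1 a01]] : exists a0 a1 : A, a0 != a1.
  have /card_gt1P[a0 [a1 [_ _ a01]]] : 1 < #|A| by rewrite hA.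
  by exists a0, a1.
split.
- by move=> Delta; apply: exists_generating_surj_condition_wrt a01.
- split; first exact: generates_setT.
  exists setT => [|d _]; first exact: generates_setT.
  by have [h [_ hE]] := Dom_involution (Dom d) a01; exists h.
(* [G] itself, viewed inside [riAut A], serves as the generating set [D]. *)
- move=> G _ /surj_rho_generates gG; exists (@maxmap A @` G) => // _ [g Gg <-].
  by exists g.
- exists [set g : thompson A | Dom g <> long a0 1].
    exact: generates_Dom_long1 a01.
  by move=> /(surj_condition_long1 a01)[g /= ].
- exact: no_surjection_onto_riAut.
Qed.
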